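(* Let $\delta\in\,]0,1]$, let $\widehat y\in\mathbb{R}^n$ satisfy $\|y-\widehat y\|\le\delta$, and let $(\widehat w_t)_{t\in\mathbb{N}}$ be the sequence generated by the algorithm ADGD with datum $\widehat y$. Assume that there exists $\bar v\in\mathbb{R}^n$ such that $-X^T\bar v\in\partial R(w^\dagger)$. Set $a=4\|X\|^{-1}$ and $b=2\|X\|\,\|v^\dagger\|/\alpha$, where $v^\dagger$ is a solution of the dual problem $\min_{v\in\mathbb{R}^n} R^*(-X^Tv)+\langle y,v\rangle$. Then, for every $t\ge 2$, $$\|\widehat w_t-w^\dagger\|\le a\,t\,\delta+b\,t^{-1}.$$ In particular, choosing $t_\delta=\lceil c\,\delta^{-1/2}\rceil$ for some $c>0$, $$\|\widehat w_{t_\delta}-w^\dagger\|\le\big[a(c+1)+b\,c^{-1}\big]\delta^{1/2}.$$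
   Context: $X\in\mathbb{R}^{n\times p}$ is a nonzero matrix, viewed as a linear map $\mathbb{R}^p\to\mathbb{R}^n$, and $\|X\|$ is its operator norm (Euclidean norms). $R:\mathbb{R}^p\to\,]-\infty,+\infty]$ is proper, lower semicontinuous and strongly convex, written as $R=F+\frac{\alpha}{2}\|\cdot\|^2$ with $\alpha\in\,]0,+\infty[$ and $F:\mathbb{R}^p\to\,]-\infty,+\infty]$ proper, lower semicontinuous and convex. $y\in\mathbb{R}^n$ is the exact datum and $w^\dagger\in\mathbb{R}^p$ is the (assumed existing, unique) solution of: minimize $R(w)$ subject to $Xw=y$; in particular $y=Xw^\dagger$. $R^*$ denotes the Fenchel conjugate of $R$, and $\partial R$ its convex subdifferential. Proximity operator: $\operatorname{prox}_{\alpha^{-1}F}(w)=\operatorname{argmin}_{u\in\mathbb{R}^p}\{F(u)+\frac{\alpha}{2}\|u-w\|^2\}$. Accelerated Dual Gradient Descent (ADGD) with datum $\widehat y$: let $\widehat v_0=\widehat z_{-1}=0\in\mathbb{R}^n$, $\gamma=\alpha\|X\|^{-2}$, $\theta_0=1$. For $t=0,1,2,\dots$: $$\widehat r_t=\operatorname{prox}_{\alpha^{-1}F}(-\alpha^{-1}X^T\widehat v_t),\qquad \widehat z_t=\widehat v_t+\gamma(X\widehat r_t-\widehat y),\qquad \widehat w_t=\operatorname{prox}_{\alpha^{-1}F}(-\alpha^{-1}X^T\widehat z_t),$$ $$\theta_{t+1}=\frac{1+\sqrt{1+4\theta_t^2}}{2},\qquad \widehat v_{t+1}=\widehat z_t+\frac{\theta_t-1}{\theta_{t+1}}(\widehat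 z_t-\widehat z_{t-1}).$$ *)

(* Defs.v *)
From HB Require Import structures.
From mathcomp Require Import all_boot all_order all_algebra.
From mathcomp Require Import all_classical all_reals all_analysis.

Set Implicit Arguments.
Unset Strict Implicit.
Unset Printing Implicit Defensive.

Import Order.TTheory GRing.Theory Num.Theory.
Import numFieldNormedType.Exports.

Local Open Scope classical_set_scope.
Local Open Scope ring_scope.

Section euclidean.
Context {K : realType}.

Definition inner (m : nat) (u v : 'cV[K]_m) : K := \sum_(i < m) u i 0 * v i 0.

(* The library norm `|u| on matrices is the sup norm, hence this one. *)
Definition l2norm (m : nat) (u : 'cV[K]_m) : K := Num.sqrt (inner u u).

Definition opnorm (m n : nat) (X : 'M[K]_(m, n)) : K :=
  sup [set l2norm (X *m w) | w in [set w : 'cV[K]_n | l2norm w <= 1]].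

End euclidean.

Section convex_analysis.
Context {K : realType}.

Definition argmin (T : Type) (D : set T) (f : T -> \bar K) : set T :=
  [set x | D x /\ forall x', D x' -> (f x <= f x')%E].

Definition eproper (T : Type) (f : T -> \bar K) : Prop :=
  (forall x, f x != -oo%E) /\ (exists x, f x != +oo%E).

Definition econvex (m : nat) (f : 'cV[K]_m -> \bar K) : Prop :=
  forall (u v : 'cV[K]_m) (s : K), 0 < s -> s < 1 ->
    (f (s *: u + (1 - s) *: v)%R <= s%:E * f u + (1 - s)%:E * f v)%E.

Definition fenchel (m : nat) (f : 'cV[K]_m -> \bar K) (s : 'cV[K]_m) : \bar K :=
  ereal_sup [set ((inner s w)%:E - f w)%E | w in [set: 'cV[K]_m]].

Definition subdiff (m : nat) (f : 'cV[K]_m -> \bar K) (w : 'cV[K]_m) :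
    set 'cV[K]_m :=
  [set s | forall u, (f w + (inner s (u - w))%:E <= f u)%E].

(* prox alpha F is prox_{alpha^-1 F}. The default value 0 of xget is used only
   when there is no minimizer; for F proper, lower semicontinuous and convex
   and alpha > 0 the minimizer exists and is unique. *)
Definition prox (m : nat) (alpha : K) (F : 'cV[K]_m -> \bar K) (w : 'cV[K]_m) :
    'cV[K]_m :=
  xget 0 (argmin setT
            (fun u => F u + (alpha / 2 * l2norm (u - w) ^+ 2)%:E)%E).

Definition primal_solution (n p : nat) (R : 'cV[K]_p -> \bar K)
    (X : 'M[K]_(n, p)) (y : 'cV[K]_n) : set 'cV[K]_p :=
  argmin [set w | X *m w = y] R.

Definition dual_solution (n p : nat) (R : 'cV[K]_p -> \bar K)
    (X : 'M[K]_(n, p)) (y : 'cV[K]_n) : set 'cV[K]_n :=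
  argmin setT (fun v => fenchel R (- (X^T *m v))%R + (inner y v)%:E)%E.

End convex_analysis.

Section adgd.
Context {K : realType} (n p : nat).
Context (alpha : K) (F : 'cV[K]_p -> \bar K) (X : 'M[K]_(n, p)).
Context (yhat : 'cV[K]_n).

Fixpoint adgd_theta (t : nat) : K :=
  if t is s.+1 then (1 + Num.sqrt (1 + 4 * adgd_theta s ^+ 2)) / 2 else 1.

Definition adgd_gamma : K := alpha * opnorm X ^- 2.

Definition adgd_prox (u : 'cV[K]_n) : 'cV[K]_p :=
  prox alpha F (- (alpha^-1 *: (X^T *m u))).

Definition adgd_step (v : 'cV[K]_n) : 'cV[K]_n :=
  v + adgd_gamma *: (X *m adgd_prox v - yhat).

(* The pair (v_t, z_(t-1)), where z_(-1) = 0. *)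
Fixpoint adgd_vz (t : nat) : 'cV[K]_n * 'cV[K]_n :=
  if t is s.+1 then
    let: (v, zprev) := adgd_vz s in
    let z := adgd_step v in
    (z + ((adgd_theta s - 1) / adgd_theta s.+1) *: (z - zprev), z)
  else (0, 0).

Definition adgd_v (t : nat) : 'cV[K]_n := (adgd_vz t).1.

Definition adgd_z (t : nat) : 'cV[K]_n := adgd_step (adgd_v t).

Definition adgd_w (t : nat) : 'cV[K]_p := adgd_prox (adgd_z t).

End adgd.

(* Main.v *)
Require Import Defs.
From mathcomp Require Import all_boot all_order all_algebra.
From mathcomp Require Import all_classical all_reals all_analysis.
From mathcomp Require Import ring lra.

(* ADGD is FISTA for the dual objective with [yhat] in place of [y].  A
   subgradient inequality of a strongly convex function keeps the quadratic
   term, so the dual objective D is smooth with constant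
   [L = opnorm X ^+ 2 / alpha], and
   [alpha / 2 * l2norm (w_t - wdag) ^+ 2 <= D z_t - D vdag].  The FISTA energy
   inequality holds for any comparison point, in particular for [vdag], although
   [vdag] does not minimize the perturbed objective (which need not have a
   minimizer).  The two objectives differ by the linear form
   [inner (y - yhat)], and [theta_t ^+ 2 *: (z_t - vdag)] is the sum of the
   [theta_k *: (u_k - vdag)] for [k <= t], where [u_k] is the auxiliary
   sequence of the energy; this bounds the distance from [u_t] to [vdag], and
   then [theta_t ^+ 2 * (D z_t - D vdag)], by a quadratic inequality. *)

Set Implicit Arguments.
Unset Strict Implicit.

Import Order.TTheory GRing.Theory Num.Theory.
Import numFieldNormedType.Exports.

Local Open Scope classical_set_scope.
Local Open Scope ring_scope.

(** * Euclidean inner product and operator norm *)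

Section euclidean.
Context {K : realType}.

Lemma innerC m (u v : 'cV[K]_m) : inner u v = inner v u.
Proof. by apply: eq_bigr => i _; rewrite mulrC. Qed.

Lemma innerDl m (u v w : 'cV[K]_m) : inner (u + v) w = inner u w + inner v w.
Proof. by rewrite -big_split; apply: eq_bigr => i _; rewrite mxE mulrDl. Qed.

Lemma innerZl m a (u v : 'cV[K]_m) : inner (a *: u) v = a * inner u v.
Proof. by rewrite mulr_sumr; apply: eq_bigr => i _; rewrite mxE mulrA. Qed.

Lemma innerNl m (u v : 'cV[K]_m) : inner (- u) v = - inner u v.
Proof. by rewrite -scaleN1r innerZl mulN1r. Qed.

Lemma innerDr m (u v w : 'cV[K]_m) : inner u (v + w) = inner u v + inner u w.
Proof. by rewrite innerC innerDl !(innerC u). Qed.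

Lemma innerZr m a (u v : 'cV[K]_m) : inner u (a *: v) = a * inner u v.
Proof. by rewrite innerC innerZl innerC. Qed.

Lemma innerNr m (u v : 'cV[K]_m) : inner u (- v) = - inner u v.
Proof. by rewrite innerC innerNl innerC. Qed.

Lemma inner0l m (u : 'cV[K]_m) : inner 0 u = 0.
Proof. by rewrite -(scale0r 0) innerZl mul0r. Qed.

Definition innerE := (innerDl, innerDr, innerNl, innerNr, innerZl, innerZr).

Lemma inner_mulmx m n (A : 'M[K]_(m, n)) u v :
  inner (A *m u) v = inner u (A^T *m v).
Proof.
have E k (a b : 'cV[K]_k) : inner a b = (a^T *m b) 0 0.
  by rewrite mxE; apply: eq_bigr => i _; rewrite mxE.
by rewrite !E trmx_mul -mulmxA.
Qed.

Lemma inner_ge0 m (u : 'cV[K]_m) : 0 <= inner u u.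
Proof. by apply: sumr_ge0 => i _; rewrite -expr2 sqr_ge0. Qed.

Lemma l2norm_ge0 m (u : 'cV[K]_m) : 0 <= l2norm u.
Proof. exact: sqrtr_ge0. Qed.

Lemma l2norm_sqr m (u : 'cV[K]_m) : l2norm u ^+ 2 = inner u u.
Proof. by rewrite sqr_sqrtr ?inner_ge0. Qed.

Lemma l2norm0 m : l2norm (0 : 'cV[K]_m) = 0.
Proof. by rewrite /l2norm inner0l sqrtr0. Qed.

Lemma l2normN m (u : 'cV[K]_m) : l2norm (- u) = l2norm u.
Proof. by rewrite /l2norm innerNl innerNr opprK. Qed.

Lemma l2normZ m a (u : 'cV[K]_m) : l2norm (a *: u) = `|a| * l2norm u.
Proof.
by rewrite /l2norm innerZl innerZr mulrA -expr2 sqrtrM ?sqr_ge0// sqrtr_sqr.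
Qed.

Lemma coord_le_l2norm m (u : 'cV[K]_m) i : `|u i 0| <= l2norm u.
Proof.
rewrite -sqrtr_sqr ler_sqrt ?inner_ge0// /inner (bigD1 i)//= -expr2 lerDl.
by apply: sumr_ge0 => j _; rewrite -expr2 sqr_ge0.
Qed.

Lemma l2norm_eq0 m (u : 'cV[K]_m) : l2norm u = 0 -> u = 0.
Proof.
move=> u0; apply/colP => i; rewrite mxE; apply/eqP.
by rewrite -normr_le0 -u0 coord_le_l2norm.
Qed.

Lemma inner_sqr_le m (u v : 'cV[K]_m) :
  inner u v ^+ 2 <= inner u u * inner v v.
Proof.
have [v0|v0] := eqVneq (l2norm v) 0.
  by rewrite (l2norm_eq0 v0) innerC !inner0l mulr0 expr0n.
have vv : 0 < inner v v.
  by rewrite -l2norm_sqr exprn_gt0// lt_neqAle eq_sym v0 l2norm_ge0.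
(* The square of this norm is [c * (a * c - b ^+ 2)], in the notation set below. *)
have := inner_ge0 (inner v v *: u - inner u v *: v).
rewrite !innerE (innerC v u).
set a := inner u u; set b := inner u v; set c := inner v v => h.
have : 0 <= c * (a * c - b ^+ 2) by lra.
by rewrite pmulr_rge0// subr_ge0.
Qed.

Lemma inner_le m (u v : 'cV[K]_m) : inner u v <= l2norm u * l2norm v.
Proof.
apply: le_trans (ler_norm _) _.
rewrite -sqrtrM ?inner_ge0// -sqrtr_sqr ler_sqrt ?inner_sqr_le//.
by rewrite mulr_ge0 ?inner_ge0.
Qed.

Lemma opnorm_has_sup n p (X : 'M[K]_(n, p)) :
  has_sup [set l2norm (X *m w) | w in [set w : 'cV[K]_p | l2norm w <= 1]].
Proof.
split; first by exists (l2norm (X *m 0)), 0 => //=; rewrite l2norm0.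
(* The bound is the Frobenius norm, by Cauchy-Schwarz on each row. *)
exists (Num.sqrt (\sum_i inner (row i X)^T (row i X)^T)) => _ [w /= w1 <-].
rewrite ler_sqrt; last by apply: sumr_ge0 => i _; exact: inner_ge0.
apply: ler_sum => i _.
have -> : (X *m w) i 0 = inner (row i X)^T w.
  by rewrite mxE; apply: eq_bigr => j _; rewrite !mxE.
rewrite -expr2; apply: le_trans (inner_sqr_le _ _) _.
by rewrite ler_piMr ?inner_ge0// -l2norm_sqr expr_le1// l2norm_ge0.
Qed.

Lemma opnorm_ge0 n p (X : 'M[K]_(n, p)) : 0 <= opnorm X.
Proof.
apply: (ub_le_sup (proj2 (opnorm_has_sup X))).
by exists 0 => /=; rewrite ?mulmx0 l2norm0 ?ler01.
Qed.

Lemma l2norm_mulmx_le n p (X : 'M[K]_(n, p)) w :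
  l2norm (X *m w) <= opnorm X * l2norm w.
Proof.
have [w0|w0] := eqVneq (l2norm w) 0.
  by rewrite (l2norm_eq0 w0) mulmx0 !l2norm0 mulr0.
have wgt0 : 0 < l2norm w by rewrite lt_neqAle eq_sym w0 l2norm_ge0.
rewrite -ler_pdivrMr//.
apply: (ub_le_sup (proj2 (opnorm_has_sup X))).
exists ((l2norm w)^-1 *: w) => /=.
  by rewrite l2normZ ger0_norm ?invr_ge0 ?l2norm_ge0// mulVf.
by rewrite -scalemxAr l2normZ ger0_norm ?invr_ge0 ?l2norm_ge0// mulrC.
Qed.

Lemma opnorm_gt0 n p (X : 'M[K]_(n, p)) : X != 0 -> 0 < opnorm X.
Proof.
move=> X0; rewrite lt_neqAle opnorm_ge0 andbT eq_sym.
apply: contra_neq X0 => X0; apply/matrixP => i j.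
have Xw w : X *m w = 0 :> 'cV_n.
  apply: l2norm_eq0; apply/eqP; rewrite eq_le l2norm_ge0 andbT.
  by have := l2norm_mulmx_le X w; rewrite X0 mul0r.
by have /colP/(_ i) := Xw (delta_mx j 0); rewrite -colE !mxE.
Qed.

(** The squared norm of [X^T *m v] is the inner product of [X *m (X^T *m v)] and [v]; Cauchy-Schwarz
    and division by the norm of [X^T *m v] conclude. *)
Lemma l2norm_trmx_mulmx_le n p (X : 'M[K]_(n, p)) v :
  l2norm (X^T *m v) <= opnorm X * l2norm v.
Proof.
have [->|h0] := eqVneq (l2norm (X^T *m v)) 0.
  by rewrite mulr_ge0 ?opnorm_ge0 ?l2norm_ge0.
have hgt0 : 0 < l2norm (X^T *m v) by rewrite lt_neqAle eq_sym h0 l2norm_ge0.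
rewrite -(ler_pM2r hgt0) -expr2 l2norm_sqr inner_mulmx trmxK.
apply: le_trans (inner_le _ _) _.
by rewrite mulrC mulrAC ler_wpM2r ?l2norm_ge0// l2norm_mulmx_le.
Qed.

End euclidean.

(** * Subgradients of strongly convex functions and the proximity operator *)

Section convex_analysis.
Context {K : realType} {p : nat}.
Variables (alpha : K) (F : 'cV[K]_p -> \bar K).
Hypothesis alpha_gt0 : 0 < alpha.
Hypotheses (F_proper : eproper F) (F_convex : econvex F).

Local Notation reg u := (alpha / 2 * l2norm u ^+ 2).

Implicit Types u v w x r xi : 'cV[K]_p.

Lemma proper_fin_num u : (F u < +oo)%E -> F u \is a fin_num.
Proof. by move=> Fu; rewrite fin_numE (proj1 F_proper) -ltey. Qed.

(** Stands in for the limit as [s] decreases to 0. If [d] were positive, the [s] chosen in the proof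
    would give [s * c < d]. *)
Lemma le0_small_slope (c d : K) :
  (forall s, 0 < s -> s < 1 -> d <= s * c) -> d <= 0.
Proof.
move=> h; rewrite leNgt; apply/negP => d0.
have e0 : 0 < d + `|c| + 1 by rewrite ltr_wpDl// addr_ge0// ltW.
have := h (d / (2 * (d + `|c| + 1))).
rewrite divr_gt0 ?mulr_gt0// ltr_pdivrMr ?mulr_gt0// mul1r => /(_ isT).
have cc := ler_norm c; have c0 := normr_ge0 c.
move=> /(_ ltac:(lra)).
rewrite mulrAC ler_pdivlMr ?mulr_gt0//; nra.
Qed.

Lemma argmin_fin_num w r :
  argmin setT (fun u => F u + (reg (u - w))%:E)%E r -> F r \is a fin_num.
Proof.
move=> [_ rmin]; have [x Fx] := proj2 F_proper; rewrite -ltey in Fx.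
have := rmin x I; have /fineK <- := proper_fin_num Fx.
move=> h; apply: proper_fin_num; rewrite ltey; apply/negP => /eqP Fr.
by move: h; rewrite Fr addye// -EFinD leye_eq.
Qed.

(** First-order optimality: [r] is compared with [s *: u + (1 - s) *: r], then the inequality is
    divided by [s], which tends to 0. *)
Lemma argmin_subdiff w r :
  argmin setT (fun u => F u + (reg (u - w))%:E)%E r ->
  subdiff F r (alpha *: (w - r)).
Proof.
move=> rmin u; have /fineK fr := argmin_fin_num rmin.
have [->|Fu] := eqVneq (F u) +oo%E; first by rewrite leey.
rewrite -ltey in Fu; have /fineK fu := proper_fin_num Fu.
rewrite -fr -fu -EFinD lee_fin -subr_le0.
apply: (@le0_small_slope (alpha / 2 * inner (u - r) (u - r))) => s s0 s1.
have cvx := F_convex u r s0 s1.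
have := proj2 rmin (s *: u + (1 - s) *: r) I.
rewrite -fr => h; have {cvx h} := le_trans h (leeD2r _ cvx).
rewrite -fr -fu -!EFinM -!EFinD lee_fin !l2norm_sqr => h.
rewrite -(ler_pM2l s0); move: h.
rewrite !innerE (innerC r u) (innerC w u) (innerC w r); lra.
Qed.

Variable R : 'cV[K]_p -> \bar K.
Hypothesis RE : forall w, R w = (F w + (reg w)%:E)%E.

(** Completing the square turns [R u - inner s u] into the proximal objective at [alpha^-1 *: s], up
    to a constant. *)
Lemma subdiff_argmin w (s : 'cV[K]_p) : subdiff R w s ->
  argmin setT (fun u => F u + (reg (u - alpha^-1 *: s))%:E)%E w.
Proof.
move=> sw; split=> // u _.
have [->|Fu] := eqVneq (F u) +oo%E; first by rewrite addye// leey.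
rewrite -ltey in Fu; have /fineK fu := proper_fin_num Fu.
have := sw u.
have Fw : (F w < +oo)%E.
  have := sw u; rewrite !RE -fu ltey; apply: contraTneq => ->.
  by rewrite !addye// -EFinD leye_eq.
have /fineK fw := proper_fin_num Fw.
rewrite !RE -fu -fw -!EFinD !lee_fin !l2norm_sqr !innerE.
rewrite (innerC s u) (innerC s w) => h.
have a0 : alpha != 0 by rewrite gt_eqF.
rewrite -subr_ge0; rewrite -subr_ge0 in h; apply: le_trans h _.
by rewrite le_eqVlt; apply/orP; left; apply/eqP; field.
Qed.

(** The two previous lemmas make [s - alpha *: w] a subgradient of [F] at [w]; expanding the
    quadratic part of [R] exactly gives the extra term. *)
Lemma subdiff_strong w (s : 'cV[K]_p) u : subdiff R w s ->
  (R w + (inner s (u - w) + reg (u - w))%:E <= R u)%E.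
Proof.
move=> sw; have wmin := subdiff_argmin sw.
have /fineK fw := argmin_fin_num wmin.
have [Fu|Fu] := eqVneq (F u) +oo%E; first by rewrite [R u]RE Fu addye// leey.
rewrite -ltey in Fu; have /fineK fu := proper_fin_num Fu.
have := argmin_subdiff wmin u.
rewrite !RE -fu -fw -!EFinD !lee_fin !l2norm_sqr !innerE.
rewrite (innerC w u) => h; have a0 : alpha != 0 by rewrite gt_eqF.
rewrite -subr_ge0; rewrite -subr_ge0 in h; apply: le_trans h _.
by rewrite le_eqVlt; apply/orP; left; apply/eqP; field.
Qed.

Lemma continuous_reg w : continuous (fun u : 'cV[K]_p => reg (u - w)).
Proof.
have -> : (fun u : 'cV[K]_p => reg (u - w)) =
    (fun u => alpha / 2 * \sum_(i < p) (u i 0 - w i 0) * (u i 0 - w i 0)).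
  apply/funext => u; rewrite l2norm_sqr; congr (_ * _).
  by apply: eq_bigr => i _; rewrite !mxE.
have cB i : continuous (fun u : 'cV[K]_p => u i 0 - w i 0).
  move=> x.
  apply: (@cvgB K K _ (nbhs x) _ (fun u : 'cV[K]_p => u i 0) (cst (w i 0))).
    exact: coord_continuous.
  exact: cvg_cst.
move=> x; apply: (@cvgM _ _ (nbhs x) _ (cst (alpha / 2))); first exact: cvg_cst.
apply: continuous_big => [|i _ u]; first exact: add_continuous.
by apply: (@cvgM _ _ (nbhs u)); exact: cB.
Qed.

(** Direct method: an affine minorant bounds the objective below, strong convexity makes a
    minimizing sequence Cauchy, and lower semicontinuity passes to the limit. *)
Lemma argmin_exists w w0 xi : lower_semicontinuous F ->
  F w0 \is a fin_num -> subdiff F w0 xi ->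
  exists r, argmin setT (fun u => F u + (reg (u - w))%:E)%E r.
Proof.
move=> F_lsc /fineK fw0 sw0.
pose h u := (F u + (reg (u - w))%:E)%E.
pose A := [set a : K | exists u, h u = a%:E].
have hfin u a : h u = a%:E -> F u \is a fin_num /\ fine (F u) = a - reg (u - w).
  rewrite /h => hu; have Fu : F u \is a fin_num.
    apply: proper_fin_num; rewrite ltey.
    by apply: contra_eq_neq hu => ->; rewrite addye.
  by split=> //; apply: EFin_inj; rewrite fineK// EFinB -hu addeK.
have Ainf : has_inf A.
  split; first by exists (fine (F w0) + reg (w0 - w)), w0; rewrite /h -fw0.
  (* Minimum over [u] of the affine minorant plus the quadratic term. *)
  exists (fine (F w0) + inner xi (w - w0) - inner xi xi / (2 * alpha)) => a [u].
  move=> /hfin[/fineK fu ua]; have := sw0 u.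
  rewrite -fw0 -fu -EFinD lee_fin ua l2norm_sqr.
  have := inner_ge0 (alpha *: (u - w) + xi); rewrite !innerE.
  rewrite (innerC u xi) (innerC w xi) (innerC w u) => sq0 h0.
  set t := inner xi xi / (2 * alpha).
  have tE : inner xi xi = 2 * alpha * t.
    by rewrite /t mulrC divfK// gt_eqF// mulr_gt0.
  have : 0 <= 2 * alpha *
      (alpha / 2 * (inner u u - 2 * inner u w + inner w w)
       + inner xi u - inner xi w + t).
    by rewrite tE in sq0; lra.
  rewrite pmulr_rge0 ?mulr_gt0//; lra.
(* Convexity of [F] and the parallelogram identity, at the midpoint of [u] and [v]. *)
have midpoint u v a b : h u = a%:E -> h v = b%:E ->
    alpha / 8 * l2norm (u - v) ^+ 2 <= (a + b) / 2 - inf A.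
  move=> /hfin[/fineK fu ua] /hfin[/fineK fv vb].
  have half0 : 0 < 1 / 2 :> K by lra.
  have half1 : 1 / 2 < 1 :> K by lra.
  have := F_convex u v half0 half1.
  set x := (X in F X); rewrite -fu -fv -!EFinM -EFinD => Fx.
  have /fineK fx := proper_fin_num (le_lt_trans Fx (ltry _)).
  have : inf A <= fine (F x) + reg (x - w).
    by apply: (ge_inf (proj2 Ainf)); exists x; rewrite /h -fx.
  move: Fx; rewrite -fx lee_fin ua vb !l2norm_sqr !innerE.
  rewrite (innerC v u) (innerC w u) (innerC w v); lra.
have /choice[u_ /choice[a_ ua]] :
    forall k : nat, exists u, exists a, h u = a%:E /\ a < inf A + k.+1%:R^-1.
  move=> k; have [|a [u hu] ha] := @inf_adherent _ A k.+1%:R^-1 _ Ainf.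
    by rewrite invr_gt0.
  by exists u, a.
have : cauchy (u_ @ \oo).
  apply: cauchy_exP => e e0.
  have d0 : 0 < alpha / 8 * e ^+ 2 by rewrite mulr_gt0 ?exprn_gt0 ?divr_gt0.
  have [N] := ltr_add_invr d0; rewrite add0r => Nd.
  exists (u_ N), N => // k /= Nk; split=> // i j; rewrite ord1 /ball /=.
  have := coord_le_l2norm (u_ N - u_ k) i; rewrite !mxE => /le_lt_trans; apply.
  have [hN aN] := ua N; have [hk ak] := ua k.
  have kN : k.+1%:R^-1 <= N.+1%:R^-1 :> K by rewrite lef_pV2 ?posrE// ler_nat.
  have := midpoint _ _ _ _ hN hk; rewrite ltNge => mid; apply/negP => el.
  have : e ^+ 2 <= l2norm (u_ N - u_ k) ^+ 2.
    by rewrite lerXn2r ?nnegrE ?l2norm_ge0 ?(ltW e0).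
  have a8 : 0 < alpha / 8 by rewrite divr_gt0.
  rewrite -(ler_pM2l a8).
  move: mid Nd kN aN ak; move: (N.+1%:R^-1) (k.+1%:R^-1) => r s; lra.
move=> /cauchy_cvg/cvg_ex[x ux]; exists x; split=> // v _.
have [Fv|Fv] := eqVneq (F v) +oo%E; first by rewrite Fv addye// leey.
rewrite -ltey in Fv; have /fineK fv := proper_fin_num Fv.
have : ((inf A)%:E <= h v)%E.
  rewrite /h -fv -EFinD lee_fin; apply: (ge_inf (proj2 Ainf)).
  by exists v; rewrite /h -fv.
apply: le_trans.
rewrite -leeBrDr// -EFinB leNgt; apply/negP => hx.
(* A real level strictly below [F x], which may be infinite. Half of the gap above [inf A] is spent
   on the continuity of the quadratic term, half on the near-minimality of [u_ k]. *)
have [c cx ca] : exists2 c, (c%:E < F x)%E & inf A - reg (x - w) < c.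
  case: (F x) hx => [r| |//] => [|_].
    rewrite lte_fin => hr; exists ((inf A - reg (x - w) + r) / 2).
      by rewrite lte_fin; lra.
    by lra.
  by exists (inf A - reg (x - w) + 1); [rewrite ltry | lra].
have [V Vx cV] := F_lsc _ _ cx.
have gap0 : 0 < (c - (inf A - reg (x - w))) / 2 by lra.
have nV : \forall k \near \oo, V (u_ k) by exact: ux.
have nq : \forall k \near \oo,
    reg (x - w) - (c - (inf A - reg (x - w))) / 2 < reg (u_ k - w).
  have cq : reg (u_ k - w) @[k --> \oo] --> reg (x - w).
    exact: (cvg_comp _ _ ux (@continuous_reg w x)).
  by apply: (cvgr_gt _ cq); lra.
have nm := near_infty_natSinv_lt (PosNum gap0).
near \oo => k.
have [/hfin[/fineK fu ua'] ak] := ua k.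
have : (c%:E < F (u_ k))%E by apply: cV; near: k.
rewrite -fu lte_fin ua'.
have : reg (x - w) - (c - (inf A - reg (x - w))) / 2 < reg (u_ k - w).
  by near: k.
have /= : k.+1%:R^-1 < (PosNum gap0)%:num by near: k.
move: ak; move: (k.+1%:R^-1) => r; lra.
Unshelve. all: by end_near. Qed.

(** Makes the proximal map the gradient of the conjugate of [R]. The pair [w0], [s0] supplies the
    affine minorant of [F] for the existence of the minimizer. *)
Lemma prox_subdiff w0 (s0 s : 'cV[K]_p) :
  lower_semicontinuous F -> subdiff R w0 s0 ->
  subdiff R (prox alpha F (alpha^-1 *: s)) s.
Proof.
move=> F_lsc /subdiff_argmin wmin.
have /(xgetPex 0) := argmin_exists (alpha^-1 *: s) F_lsc
  (argmin_fin_num wmin) (argmin_subdiff wmin).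
rewrite -/(prox _ _ _); set r := prox _ _ _ => rmin u.
have /fineK fr := argmin_fin_num rmin.
have [Fu|Fu] := eqVneq (F u) +oo%E; first by rewrite [R u]RE Fu addye// leey.
rewrite -ltey in Fu; have /fineK fu := proper_fin_num Fu.
have := argmin_subdiff rmin u.
have := mulr_ge0 (ltW alpha_gt0) (inner_ge0 (u - r)).
rewrite !RE -fu -fr -!EFinD !lee_fin !l2norm_sqr !innerE (innerC r u).
rewrite !mulrBr !mulVKf ?gt_eqF//; lra.
Qed.

End convex_analysis.

(** * Fenchel duality at the primal solution *)

Section duality.
Context {K : realType} {n p : nat}.
Variables (R : 'cV[K]_p -> \bar K) (X : 'M[K]_(n, p)).

Lemma fenchel_subdiff w s : R w \is a fin_num -> subdiff R w s ->
  fenchel R s = (inner s w - fine (R w))%:E.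
Proof.
move=> /fineK rw sw; apply/le_anti/andP; split; last first.
  by rewrite EFinB rw; apply: ereal_sup_ubound; exists w.
apply: ge_ereal_sup => _ [u _ <-]; have := sw u; rewrite -rw -EFinD.
case: (R u) => [r| |] //=.
  by rewrite -EFinD !lee_fin innerDr innerNr; lra.
by rewrite addeNy leNye.
Qed.

(** The dual objective equals [- R w] at [vbar], so it is at most [- R w] at [v]; with the
    Fenchel-Young inequality at each [u], this is the subgradient inequality. *)
Lemma dual_solution_subdiff y w vbar v : R w \is a fin_num -> X *m w = y ->
  subdiff R w (- (X^T *m vbar)) -> dual_solution R X y v ->
  subdiff R w (- (X^T *m v)).
Proof.
move=> Rw Xw sbar [_ /(_ vbar I)]; rewrite (fenchel_subdiff Rw sbar) => vmin u.
have adj z x : inner (- (X^T *m z)) x = - inner (X *m x) z.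
  by rewrite innerNl innerC inner_mulmx.
have : ((inner (- (X^T *m v)) u)%:E - R u <= fenchel R (- (X^T *m v)))%E.
  by apply: ereal_sup_ubound; exists u.
move=> /(leeD2r (inner y v)%:E)/le_trans/(_ vmin).
move: Rw => /fineK <-; rewrite innerDr innerNr !adj Xw.
case: (R u) => [r| |]//=; last by rewrite leey.
by rewrite -!EFinD !lee_fin; lra.
Qed.

End duality.

(** * Smoothness of the conjugate and of the dual objective *)

Section conjugate.
Context {K : realType} {n p : nat}.
Variables (alpha : K) (R : 'cV[K]_p -> \bar K) (X : 'M[K]_(n, p)).
(* [W s] is the gradient at [s] of the Fenchel conjugate of [R], whose value
   at [s] is [conj_val s]. *)
Variable W : 'cV[K]_p -> 'cV[K]_p.
Hypothesis alpha_gt0 : 0 < alpha.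
Hypothesis R_fin : forall w s, subdiff R w s -> R w \is a fin_num.
Hypothesis R_strong : forall w s u, subdiff R w s ->
  (R w + (inner s (u - w) + alpha / 2 * l2norm (u - w) ^+ 2)%:E <= R u)%E.
Hypothesis W_subdiff : forall s, subdiff R (W s) s.

Definition conj_val s := inner s (W s) - fine (R (W s)).

Lemma subdiff_strong_fine w s w' s' : subdiff R w s -> subdiff R w' s' ->
  fine (R w) + inner s (w' - w) + alpha / 2 * l2norm (w' - w) ^+ 2
  <= fine (R w').
Proof.
move=> sw sw'; have := R_strong w' sw.
move: (R_fin sw) (R_fin sw') => /fineK {1}<- /fineK {1}<-.
by rewrite -EFinD lee_fin addrA.
Qed.

(** Fenchel-Young with a quadratic excess. It gives the convexity of the conjugate and, later, turns
    a dual gap into a primal distance. *)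
Lemma conj_val_ge w s s0 : subdiff R w s0 ->
  inner s w - fine (R w) + alpha / 2 * l2norm (w - W s) ^+ 2 <= conj_val s.
Proof.
move=> sw; have := subdiff_strong_fine (W_subdiff s) sw.
rewrite /conj_val innerDr innerNr; lra.
Qed.

Lemma conj_valE w s : subdiff R w s -> conj_val s = inner s w - fine (R w).
Proof.
move=> sw; have := subdiff_strong_fine (W_subdiff s) sw.
have := subdiff_strong_fine sw (W_subdiff s).
have h1 := mulr_ge0 (ltW alpha_gt0) (sqr_ge0 (l2norm (w - W s))).
have h2 := mulr_ge0 (ltW alpha_gt0) (sqr_ge0 (l2norm (W s - w))).
rewrite /conj_val !innerDr !innerNr; lra.
Qed.

Lemma conj_val_descent s s0 :
  conj_val s <=
  conj_val s0 + inner (s - s0) (W s0) + l2norm (s - s0) ^+ 2 / (2 * alpha).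
Proof.
have := subdiff_strong_fine (W_subdiff s0) (W_subdiff s).
rewrite /conj_val !l2norm_sqr.
move: (W s) (W s0) => w w0.
set t := _ / (2 * alpha).
have tE : inner (s - s0) (s - s0) = 2 * alpha * t.
  by rewrite /t mulrC divfK// gt_eqF// mulr_gt0.
(* Young's inequality: the strong convexity term of [R] absorbs the cross term, leaving a smoothness
   constant of [alpha^-1]. *)
have : 0 <= 2 * alpha *
    (t + alpha / 2 * inner (w - w0) (w - w0) - inner (s - s0) (w - w0)).
  move: tE; move: (s - s0) (w - w0) => a b tE.
  have := inner_ge0 (a - alpha *: b); rewrite !innerE (innerC b a) tE; lra.
rewrite pmulr_rge0 ?mulr_gt0// !innerE.
lra.
Qed.

Definition dual_val c v := conj_val (- (X^T *m v)) + inner c v.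

(** Convexity between [v] and [x] combined with the descent inequality between [v] and [z]. The
    factor [opnorm X ^+ 2] comes from composing with [X^T]. *)
Lemma dual_val_descent c x z v :
  dual_val c z <= dual_val c x
    + inner (c - X *m W (- (X^T *m v))) (z - x)
    + opnorm X ^+ 2 / alpha / 2 * l2norm (z - v) ^+ 2.
Proof.
rewrite /dual_val.
pose s (u : 'cV[K]_n) := - (X^T *m u); rewrite -!/(s _).
have hx := conj_val_ge (s x) (W_subdiff (s v)).
have hx0 := mulr_ge0 (ltW alpha_gt0) (sqr_ge0 (l2norm (W (s v) - W (s x)))).
have hz := conj_val_descent (s z) (s v).
have vE := conj_valE (W_subdiff (s v)).
have nle : l2norm (s z - s v) ^+ 2 / (2 * alpha)
    <= opnorm X ^+ 2 / alpha / 2 * l2norm (z - v) ^+ 2.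
  have -> : opnorm X ^+ 2 / alpha / 2 * l2norm (z - v) ^+ 2 =
      (opnorm X * l2norm (z - v)) ^+ 2 / (2 * alpha).
    by field; rewrite gt_eqF.
  rewrite ler_pM2r ?invr_gt0 ?mulr_gt0// lerXn2r ?nnegrE ?mulr_ge0 ?opnorm_ge0
    ?l2norm_ge0// /s -opprD -mulmxBr l2normN.
  exact: l2norm_trmx_mulmx_le.
have adj u w : inner (X^T *m u) w = inner (X *m w) u.
  by rewrite innerC inner_mulmx.
move: nle hz vE hx; rewrite /s !innerE !adj; lra.
Qed.

End conjugate.

(** * One-step energy inequality of FISTA *)

Section fista.
Context {K : realType} {n : nat}.
Variables (L : K) (f : 'cV[K]_n -> K) (df : 'cV[K]_n -> 'cV[K]_n).
Hypothesis L_gt0 : 0 < L.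
Hypothesis f_descent : forall x z v,
  f z <= f x + inner (df v) (z - x) + L / 2 * l2norm (z - v) ^+ 2.

Lemma fista_energy (x v zp z : 'cV[K]_n) (theta : K) :
  1 <= theta -> z = v - L^-1 *: df v ->
  theta ^+ 2 * (f z - f x)
    + L / 2 * l2norm (zp + theta *: (z - zp) - x) ^+ 2
  <= (theta ^+ 2 - theta) * (f zp - f x)
    + L / 2 * l2norm (theta *: v - (theta - 1) *: zp - x) ^+ 2.
Proof.
move=> th1 zE.
have [d zd dE] : exists2 d, z = v - d & df v = L *: d.
  by exists (L^-1 *: df v); rewrite ?scalerA ?divff ?gt_eqF ?scale1r.
have th0 : 0 <= theta by lra.
have th10 : 0 <= theta * (theta - 1) by nra.
(* Weights [theta] at [x] and [theta * (theta - 1)] at [zp] sum to [theta ^+ 2], the weight of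
   [f z]. *)
have := ler_wpM2l th0 (f_descent x z v).
have := ler_wpM2l th10 (f_descent zp z v).
rewrite !l2norm_sqr dE.
move: (f z) (f zp) (f x) => fz fzp fx.
rewrite zd !innerE.
rewrite (innerC d v) (innerC zp v) (innerC x v) (innerC zp d) (innerC x d).
rewrite (innerC x zp); lra.
Qed.

End fista.

(* One step of a Gronwall-type induction: [T] is the sum of the previous
   parameters, and the assumptions force [A <= V + k * (T + theta)]. *)
Lemma error_step (K : realType) (L V k T theta A G G' : K) :
  0 < L -> 0 <= V -> 0 <= k -> 0 <= T -> 0 <= theta -> 0 <= A ->
  G <= L / 2 * (k * T * (V + k * T)) ->
  G' <= G + L / 2 * (k * theta * A) ->
  L / 2 * A ^+ 2 <= L / 2 * V ^+ 2 + G' ->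
  G' <= L / 2 * (k * (T + theta) * (V + k * (T + theta))).
Proof.
move=> L0 V0 k0 T0 th0 A0 hG hG' hA.
have L20 : 0 < L / 2 by lra.
have kT := mulr_ge0 k0 T0; have kth := mulr_ge0 k0 th0.
(* Otherwise [A * (A - k * theta)] would exceed its value at this bound, which is at least
   [V ^+ 2 + k * T * (V + k * T)]. *)
have AB : A <= V + k * (T + theta).
  rewrite leNgt; apply/negP => BA.
  have : L / 2 * A ^+ 2 <=
      L / 2 * (V ^+ 2 + k * T * (V + k * T) + k * theta * A) by lra.
  rewrite ler_pM2l//; nra.
apply: le_trans hG' _; apply: le_trans (lerD hG (lexx _)) _.
rewrite -mulrDr ler_pM2l//; nra.
Qed.

(** * Energy and accumulated error along the ADGD iterates *)

Section adgd_iterates.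
Context {K : realType} {n p : nat}.
Variables (alpha : K) (F : 'cV[K]_p -> \bar K) (X : 'M[K]_(n, p)).
Variable yhat : 'cV[K]_n.

Local Notation theta := (@adgd_theta K).
Local Notation v_ := (adgd_v alpha F X yhat).
Local Notation z_ := (adgd_z alpha F X yhat).

Lemma adgd_theta_ge1 t : 1 <= theta t.
Proof.
case: t => [//|t] /=; rewrite ler_pdivlMr// mul1r (_ : 2 = 1 + 1)//.
rewrite lerD2l -[leLHS]sqrtr1 ler_sqrt; last by have := sqr_ge0 (theta t); lra.
by have := sqr_ge0 (theta t); lra.
Qed.

(** The recursion picks the positive root of this quadratic equation. Consequently [theta t ^+ 2] is
    the sum of the [theta k] for [k <= t]. *)
Lemma adgd_theta_sqr t : theta t.+1 ^+ 2 - theta t.+1 = theta t ^+ 2.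
Proof.
rewrite /=; set q := 1 + 4 * _; have q0 : 0 <= q.
  by rewrite /q; have := sqr_ge0 (theta t); lra.
have := sqr_sqrtr q0; move: (Num.sqrt q) => r rE.
have -> : theta t ^+ 2 = (q - 1) / 4 by rewrite /q; field.
by rewrite -rE; field.
Qed.

Lemma adgd_theta_bounds t : t.+2%:R / 2 <= theta t <= t.+1%:R.
Proof.
elim: t => [|t /andP[lo hi]]; first by rewrite /= divff ?lexx.
(* At [a + 1 / 2] and [a + 1], the polynomial [x ^+ 2 - x] takes the values [a ^+ 2 - 1 / 4] and
   [a ^+ 2 + a], which enclose [a ^+ 2]. *)
have [lo' hi'] : theta t + 1 / 2 <= theta t.+1 /\ theta t.+1 <= theta t + 1.
  move: (adgd_theta_ge1 t) (adgd_theta_ge1 t.+1) (adgd_theta_sqr t).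
  clear; move: (theta t) (theta t.+1) => a b a1 b1 ab.
  by split; rewrite leNgt; apply/negP => ba; nra.
rewrite -[t.+3]addn1 -[t.+2]addn1 !natrD; rewrite -[t.+2]addn1 natrD in lo.
by apply/andP; split; lra.
Qed.

Definition adgd_zprev t := (adgd_vz alpha F X yhat t).2.

Definition adgd_u t := adgd_zprev t + theta t *: (z_ t - adgd_zprev t).

Lemma adgd_zprevS t : adgd_zprev t.+1 = z_ t.
Proof.
by rewrite /adgd_zprev /adgd_z /adgd_v /=; case: (adgd_vz _ _ _ _ t).
Qed.

Lemma adgd_vS t :
  v_ t.+1 = z_ t + ((theta t - 1) / theta t.+1) *: (z_ t - adgd_zprev t).
Proof.
by rewrite /adgd_zprev /adgd_z /adgd_v /=; case: (adgd_vz _ _ _ _ t).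
Qed.

(** The extrapolation coefficient is designed for this: the distance on the right of the energy
    inequality at [t.+1] is the one on the left at [t], so the energies telescope. *)
Lemma adgd_u_extrapolation t :
  theta t.+1 *: v_ t.+1 - (theta t.+1 - 1) *: z_ t = adgd_u t.
Proof.
have th0 : theta t.+1 != 0.
  by rewrite gt_eqF// (lt_le_trans ltr01)// adgd_theta_ge1.
rewrite adgd_vS /adgd_u; move: (theta t.+1) th0 => th th0.
by apply/colP => i; rewrite !mxE; field.
Qed.

Lemma adgd_u_average x t :
  theta t.+1 ^+ 2 *: (z_ t.+1 - x) =
  theta t ^+ 2 *: (z_ t - x) + theta t.+1 *: (adgd_u t.+1 - x).
Proof.
rewrite -(adgd_theta_sqr t) /adgd_u adgd_zprevS.
move: (theta t.+1) (z_ t) (z_ t.+1) => th z z'.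
by apply/colP => i; rewrite !mxE; ring.
Qed.

Variables (L : K) (f : 'cV[K]_n -> K) (df : 'cV[K]_n -> 'cV[K]_n).
Hypothesis L_gt0 : 0 < L.
Hypothesis f_descent : forall x z v,
  f z <= f x + inner (df v) (z - x) + L / 2 * l2norm (z - v) ^+ 2.
Hypothesis stepE : forall v, adgd_step alpha F X yhat v = v - L^-1 *: df v.

Lemma adgd_energy x t :
  theta t ^+ 2 * (f (z_ t) - f x) + L / 2 * l2norm (adgd_u t - x) ^+ 2
  <= L / 2 * l2norm x ^+ 2.
Proof.
elim: t => [|t IH].
  (* As [theta 0 = 1], the weight of the previous gap vanishes. *)
  apply: le_trans (fista_energy L_gt0 f_descent x (adgd_zprev 0)
    (adgd_theta_ge1 0) (stepE (v_ 0))) _.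
  have -> : v_ 0 = 0 by [].
  by rewrite expr1n subrr mul0r add0r scale0r scaler0 subr0 sub0r l2normN.
apply: le_trans (fista_energy L_gt0 f_descent x (adgd_zprev t.+1)
  (adgd_theta_ge1 t.+1) (stepE (v_ t.+1))) _.
by rewrite adgd_zprevS adgd_theta_sqr adgd_u_extrapolation.
Qed.

(** Here [f] is the perturbed objective and [x] minimizes the exact one, [f + inner e]. Adding the
    linear error to the energy inequality and dropping the nonnegative exact gap bounds the distance
    from [adgd_u] to [x]; [error_step] closes the recursion. *)
Lemma adgd_inexact_gap e x k t : 0 <= k -> l2norm e <= L / 2 * k ->
  (forall z, f x + inner e x <= f z + inner e z) ->
  theta t ^+ 2 * (f (z_ t) + inner e (z_ t) - (f x + inner e x))
  <= L / 2 * (l2norm x + k * theta t ^+ 2) ^+ 2.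
Proof.
move=> k0 ek xmin.
(* Weighted linear error; by [adgd_u_average] its increments are
   [inner e (theta s *: (adgd_u s - x))]. *)
pose G t := inner e (theta t ^+ 2 *: (z_ t - x)).
have GE s : G s = theta s ^+ 2 * (inner e (z_ s) - inner e x).
  by rewrite /G innerZr innerDr innerNr.
have V0 := l2norm_ge0 x.
have hA s : L / 2 * l2norm (adgd_u s - x) ^+ 2 <= L / 2 * l2norm x ^+ 2 + G s.
  have := adgd_energy x s; rewrite GE.
  have gap0 : 0 <= f (z_ s) + inner e (z_ s) - (f x + inner e x).
    by rewrite subr_ge0 xmin.
  have := mulr_ge0 (sqr_ge0 (theta s)) gap0; lra.
have th0 s : 0 <= theta s := le_trans ler01 (adgd_theta_ge1 s).
have incr s : inner e (theta s *: (adgd_u s - x))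
    <= L / 2 * (k * theta s * l2norm (adgd_u s - x)).
  rewrite innerZr; apply: le_trans (ler_wpM2l (th0 s) (inner_le _ _)) _.
  have := ler_wpM2r (mulr_ge0 (th0 s) (l2norm_ge0 (adgd_u s - x))) ek; lra.
have hG s : G s <= L / 2 * (k * theta s ^+ 2 * (l2norm x + k * theta s ^+ 2)).
  elim: s => [|s IH].
    (* The base case is a step from the empty sum. *)
    have := @error_step K L (l2norm x) k 0 (theta 0)
      (l2norm (adgd_u 0 - x)) 0 (G 0).
    rewrite !add0r (_ : theta 0 ^+ 2 = theta 0); last by rewrite /= expr1n.
    apply=> //; rewrite ?l2norm_ge0 ?mulr0 ?mul0r ?mulr0 ?addr0//.
    apply: le_trans (incr 0%N); rewrite /G /adgd_u /= expr1n !scale1r.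
    by rewrite /adgd_zprev /= add0r subr0.
  have := @error_step K L (l2norm x) k (theta s ^+ 2) (theta s.+1)
    (l2norm (adgd_u s.+1 - x)) (G s) (G s.+1).
  rewrite -[X in k * (X + _)]adgd_theta_sqr subrK; apply=> //.
  - exact: sqr_ge0.
  - exact: l2norm_ge0.
  - by rewrite {1}/G adgd_u_average innerDr lerD2l.
have := adgd_energy x t; have := hG t; rewrite GE.
have := mulr_ge0 (ltW L_gt0) (sqr_ge0 (l2norm (adgd_u t - x))).
have := mulr_ge0 (ltW L_gt0) (mulr_ge0 (mulr_ge0 k0 (sqr_ge0 (theta t))) V0).
have := mulr_ge0 (ltW L_gt0) (sqr_ge0 (k * theta t ^+ 2)).
lra.
Qed.

End adgd_iterates.

(** * From the dual gap to the primal error *)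

Lemma adgd_error (K : realType) (n p : nat)
  (X : 'M[K]_(n, p)) (hX : X != 0)
  (alpha : K) (halpha : 0 < alpha)
  (F R : 'cV[K]_p -> \bar K)
  (F_proper : eproper F) (F_lsc : lower_semicontinuous F) (F_convex : econvex F)
  (hR : forall w, R w = (F w + (alpha / 2 * l2norm w ^+ 2)%:E)%E)
  (y : 'cV[K]_n) (wdag : 'cV[K]_p) (hy : X *m wdag = y)
  (delta : K) (yhat : 'cV[K]_n) (hyhat : l2norm (y - yhat) <= delta)
  (vbar : 'cV[K]_n) (hvbar : subdiff R wdag (- (X^T *m vbar)))
  (vdag : 'cV[K]_n) (hvdag : dual_solution R X y vdag) (t : nat) :
  alpha * adgd_theta t * l2norm (adgd_w alpha F X yhat t - wdag)
  <= opnorm X *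
     (l2norm vdag + 2 * alpha * delta / opnorm X ^+ 2 * adgd_theta t ^+ 2).
Proof.
pose theta : K := adgd_theta t; rewrite -/theta; set k := 2 * alpha * delta / _.
have X0 := opnorm_gt0 hX.
pose W s := prox alpha F (alpha^-1 *: s).
have R_fin w s : subdiff R w s -> R w \is a fin_num.
  move=> /(subdiff_argmin halpha F_proper hR)/(argmin_fin_num F_proper) Fw.
  by rewrite hR fin_numD Fw.
have R_strong w s u : subdiff R w s ->
    (R w + (inner s (u - w) + alpha / 2 * l2norm (u - w) ^+ 2)%:E <= R u)%E.
  exact: (subdiff_strong halpha F_proper F_convex hR).
have W_subdiff s : subdiff R (W s) s.
  exact: (prox_subdiff halpha F_proper F_convex hR s F_lsc hvbar).
have sdag := dual_solution_subdiff (R_fin _ _ hvbar) hy hvbar hvdag.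
pose f := dual_val R X W.
have adj u : inner (- (X^T *m u)) wdag = - inner y u.
  by rewrite innerNl innerC -hy inner_mulmx.
(* Strong duality. *)
have fdag : f y vdag = - fine (R wdag).
  rewrite /f /dual_val (conj_valE halpha R_fin R_strong W_subdiff sdag) adj.
  lra.
have gap z :
    alpha / 2 * l2norm (W (- (X^T *m z)) - wdag) ^+ 2 <= f y z - f y vdag.
  have := conj_val_ge R_fin R_strong W_subdiff (- (X^T *m z)) hvbar.
  by rewrite adj fdag /f /dual_val -l2normN opprB; lra.
have fE z : f y z = f yhat z + inner (y - yhat) z.
  by rewrite /f /dual_val innerDl innerNl; lra.
pose L := opnorm X ^+ 2 / alpha.
have L0 : 0 < L by rewrite divr_gt0// exprn_gt0.
have proxE u : adgd_prox alpha F X u = W (- (X^T *m u)).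
  by rewrite /adgd_prox /W scalerN.
(* Since [adgd_gamma] is [L^-1], this is a gradient step on the perturbed dual objective. *)
have stepE v : adgd_step alpha F X yhat v =
    v - L^-1 *: (yhat - X *m W (- (X^T *m v))).
  by rewrite /adgd_step proxE -scalerN opprB /adgd_gamma /L invf_div.
have descent := dual_val_descent X halpha R_fin R_strong W_subdiff yhat.
have Lk : L / 2 * k = delta.
  by rewrite /L /k; field; rewrite !gt_eqF.
have delta0 : 0 <= delta := le_trans (l2norm_ge0 _) hyhat.
have k0 : 0 <= k.
  by rewrite divr_ge0 ?exprn_ge0 ?mulr_ge0 ?(ltW halpha) ?(ltW X0).
have ek : l2norm (y - yhat) <= L / 2 * k by rewrite Lk.
have vmin z :
    f yhat vdag + inner (y - yhat) vdag <= f yhat z + inner (y - yhat) z.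
  rewrite -!fE -subr_ge0; apply: le_trans (gap z).
  by rewrite mulr_ge0 ?sqr_ge0// ltW// divr_gt0.
have := adgd_inexact_gap L0 descent stepE t k0 ek vmin.
rewrite -!fE -/theta => h.
have th0 : 0 <= theta := le_trans ler01 (adgd_theta_ge1 t).
have {}h := le_trans (ler_wpM2l (sqr_ge0 theta) (gap _)) h.
rewrite -proxE -/(adgd_w _ _ _ _ t) in h.
have V0 := l2norm_ge0 vdag.
have lhs0 : 0 <= alpha * theta * l2norm (adgd_w alpha F X yhat t - wdag).
  by rewrite mulr_ge0 ?l2norm_ge0// mulr_ge0// ltW.
have rhs0 : 0 <= opnorm X * (l2norm vdag + k * theta ^+ 2).
  by rewrite mulr_ge0 ?addr_ge0 ?(mulr_ge0 k0) ?sqr_ge0// ltW.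
rewrite -(@ler_pXn2r _ 2)//.
move: (ler_wpM2l (ltW halpha) h).
have -> : alpha * (L / 2 * (l2norm vdag + k * theta ^+ 2) ^+ 2) =
  opnorm X ^+ 2 / 2 * (l2norm vdag + k * theta ^+ 2) ^+ 2.
  by rewrite /L; field; rewrite gt_eqF.
rewrite !exprMn; lra.
Qed.

Unset Implicit Arguments.

Theorem theorem4p2 (K : realType) (n p : nat)
  (X : 'M[K]_(n, p)) (hX : X != 0)
  (alpha : K) (halpha : 0 < alpha)
  (F R : 'cV[K]_p -> \bar K)
  (F_proper : eproper F) (F_lsc : lower_semicontinuous F) (F_convex : econvex F)
  (hR : forall w, R w = (F w + (alpha / 2 * l2norm w ^+ 2)%:E)%E)
  (y : 'cV[K]_n) (wdag : 'cV[K]_p)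
  (hwdag : unique (primal_solution R X y) wdag)
  (delta : K) (hdelta0 : 0 < delta) (hdelta1 : delta <= 1)
  (yhat : 'cV[K]_n) (hyhat : l2norm (y - yhat) <= delta)
  (hqual : exists vbar : 'cV[K]_n, subdiff R wdag (- (X^T *m vbar)))
  (vdag : 'cV[K]_n) (hvdag : dual_solution R X y vdag) :
  let a := 4 * (opnorm X)^-1 in
  let b := 2 * opnorm X * l2norm vdag / alpha in
  let what := adgd_w alpha F X yhat in
  (forall t : nat, (2 <= t)%N ->
     l2norm (what t - wdag) <= a * t%:R * delta + b * t%:R^-1) /\
  (forall c : K, 0 < c ->
     let tdelta := `|Num.ceil (c * (Num.sqrt delta)^-1)|%N in
     l2norm (what tdelta - wdag) <= (a * (c + 1) + b * c^-1) * Num.sqrt delta).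
Proof.
move=> a b what.
have [vbar hvbar] := hqual; have [[hy _] _] := hwdag.
have X0 := opnorm_gt0 hX; have V0 := l2norm_ge0 vdag.
have a0 : 0 <= a by rewrite mulr_ge0 ?invr_ge0 ?ltW.
have b0 : 0 <= b by rewrite divr_ge0 ?mulr_ge0 ?(ltW X0) ?(ltW halpha).
(* [t = 1] is included because [tdelta] may be [1]. *)
have bound t : (0 < t)%N ->
    l2norm (what t - wdag) <= a * t%:R * delta + b * t%:R^-1.
  move=> t0; have := adgd_error hX halpha F_proper F_lsc F_convex hR
    hy hyhat hvbar hvdag t.
  rewrite /= -/what; have /andP[] := @adgd_theta_bounds K t.
  have th1 := @adgd_theta_ge1 K t.
  move: (adgd_theta t) (l2norm (what t - wdag)) th1 => th N th1 lo hi h.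
  have t1 : 1 <= t%:R :> K by rewrite ler1n.
  rewrite -[t.+2]addn2 -[t.+1]addn1 !natrD in lo hi.
  have th0 : 0 < th by lra.
  have NE :
      N <= 2 * delta * th / opnorm X + opnorm X * l2norm vdag / alpha / th.
    rewrite -(ler_pM2l (mulr_gt0 halpha th0)); apply: le_trans h _.
    by rewrite le_eqVlt; apply/orP; left; apply/eqP; field; rewrite !gt_eqF.
  apply: le_trans NE _; apply: lerD.
    have -> : a * t%:R * delta = 2 * delta * (2 * t%:R) / opnorm X.
      by rewrite /a; ring.
    rewrite ler_pM2r ?invr_gt0// ler_pM2l ?mulr_gt0//; lra.
  have -> : b * t%:R^-1 = opnorm X * l2norm vdag / alpha * (t%:R / 2)^-1.
    by rewrite /b; field; rewrite !gt_eqF//; lra.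
  rewrite ler_wpM2l ?divr_ge0 ?mulr_ge0 ?(ltW X0) ?(ltW halpha)//.
  by rewrite lef_pV2 ?posrE//; lra.
split=> [t t2|c c0]; first by apply: bound; apply: ltnW.
clearbody a b; move=> /=; set tdelta := `|_|%N; set s := Num.sqrt delta.
have s0 : 0 < s by rewrite sqrtr_gt0.
have s2 : delta = s ^+ 2 by rewrite sqr_sqrtr// ltW.
have s1 : s <= 1 by rewrite -sqrtr1 ler_sqrt.
have q0 : 0 < c / s by rewrite divr_gt0.
(* The ceiling is positive, so the absolute value does not change it. *)
have tE : tdelta%:R = (Num.ceil (c / s))%:~R :> K.
  by rewrite pmulrn /tdelta gez0_abs// ltW// ceil_gt0.
have tlo : c / s <= tdelta%:R by rewrite tE ceil_ge.
have thi : tdelta%:R <= c / s + 1.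
  by rewrite tE -lerBlDr -(intrB _ _ 1) ltW// ceilB1_lt.
have t0 : 0 < tdelta%:R :> K := lt_le_trans q0 tlo.
apply: le_trans (bound _ _) _; first by rewrite -(ltr0n K).
rewrite mulrDl; apply: lerD.
  rewrite -!mulrA ler_wpM2l// s2.
  apply: le_trans (ler_wpM2r (sqr_ge0 _) thi) _.
  (* Here [delta <= 1] enters, through [s <= 1]. *)
  have -> : (c / s + 1) * s ^+ 2 = (c + s) * s by field; rewrite gt_eqF.
  by rewrite ler_pM2r// lerD2l.
rewrite -mulrA ler_wpM2l// mulrC -invf_div.
by rewrite lef_pV2 ?posrE.
Qed.
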